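(* Let $\mathcal{H}$ be a real Hilbert space, $C\subset\mathcal{H}$ a nonempty closed convex set and $x_0\in C$. Let $(T_n)_{n\ge 0}$ be a sequence of mappings $T_n:C\to C$ which belongs to the $\mathcal{T}_C$-class (each $T_n\in\mathcal{T}_C$) and is coherent, and let $F=\bigcap_{n\in\mathbb{N}}\mathrm{Fix}(T_n)$. If $F\neq\emptyset$, then the sequence $(x_n)_{n\ge 0}$ produced from $x_0$ by the shrinking projection algorithm associated with $(T_n)$, and likewise the sequence $(x_n)_{n\ge 0}$ produced from $x_0$ by the Haugazeau-type algorithm associated with $(T_n)$, converges strongly (in norm) to $P_F x_0$.
   Context: $P_D$ denotes the metric projection onto a nonempty closed convex set $D$. $\mathrm{Fix}(T)=\{x\in C: Tx=x\}$. For $S\subset\mathcal{H}$ and $(x,y)\in\mathcal{H}^2$, $H_S(x,y)=\{z\in S:\langle z-y,x-y\rangle\le 0\}$ and $H(x,y)=H_{\mathcal{H}}(x,y)$. $\mathcal{T}_C$-class: $\mathcal{T}_C$ is the set of mappings $T:C\to C$ (defined on all of $C$) such that $\mathrm{Fix}(T)\subset H(x,Tx)$ for all $x\in C$. Coherence: a sequence $(T_n)_{n\ge0}$ in $\mathcal{T}_C$ is coherent if for every bounded sequence $(z_n)_{n\ge 0}$ in $C$ with $\sum_{n\ge0}\|z_{n+1}-z_n\|^2<\infty$ and $\sum_{n\ge 0}\|z_n-T_nz_n\|^2<\infty$, every weak cluster point of $(z_n)$ belongs to $\bigcap_{n\ge0}\mathrm{Fix}(T_n)$. Haugazeau-type algorithm: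 given $x_0\in C$, $x_{n+1}=Q_C(x_0,x_n,T_nx_n)$, where $Q_C(x,y,z)$ is the metric projection (when it exists) of $x$ onto $H_C(x,y)\cap H_C(y,z)$. Shrinking projection algorithm: given $x_0\in C$ and $C_0=C$, set $C_{n+1}=C_n\cap H(x_n,T_nx_n)$ and $x_{n+1}=P_{C_{n+1}}x_0$ (the algorithm stops if $C_{n+1}=\emptyset$). *)

(* Defs.v *)
(* MathComp-Analysis.  A real Hilbert space is a complete normed module H over
   a realType R together with an inner product dot : {dot H for idfun} that
   induces the norm, i.e. dot u u = `|u| ^+ 2. *)
From HB Require Import structures.
From mathcomp Require Import all_boot all_order all_algebra.
From mathcomp Require Import all_classical all_reals all_analysis.

Set Implicit Arguments.
Unset Strict Implicit.
Unset Printing Implicit Defensive.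

Import Order.TTheory GRing.Theory Num.Theory.
Import numFieldNormedType.Exports.

Local Open Scope classical_set_scope.
Local Open Scope ring_scope.

Definition dual (R : realType) (H : normedModType R) : Type :=
  {f : {linear H -> R^o} | continuous (f : H -> R^o)}.

(* H carrying the coarsest topology that makes every element of its
   topological dual continuous. *)
Definition weak_space (R : realType) (H : normedModType R) : topologicalType :=
  initial_topology
    ((fun x f => sval f x) : H -> {ptws dual H -> R^o}).

Definition weak_cluster_point (R : realType) (H : normedModType R)
    (z : nat -> H) (p : H) : Prop :=
  cluster ((z : nat -> weak_space H) @ \oo) (p : weak_space H).

(* At most one p satisfies this when D is a convex subset of a Hilbert space. *)
Definition is_metric_projection (R : realType) (H : normedModType R)
    (D : set H) (x p : H) : Prop :=
  D p /\ forall q, D q -> `|x - p| <= `|x - q|.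

(* H_S(x, y); when x = y it is the whole of S. *)
Definition half_space (R : realType) (H : normedModType R)
    (dot : {dot H for idfun}) (S : set H) (x y : H) : set H :=
  [set z | S z /\ dot (z - y) (x - y) <= 0].

(* A mapping C -> C is encoded as a function H -> H mapping C to C; its values
   outside of C are never used. *)
Definition Fix (R : realType) (H : normedModType R) (C : set H)
    (T : H -> H) : set H :=
  [set x | C x /\ T x = x].

Definition T_class (R : realType) (H : normedModType R)
    (dot : {dot H for idfun}) (C : set H) (T : H -> H) : Prop :=
  set_fun C C T /\
  forall x, C x -> Fix C T `<=` half_space dot setT x (T x).

Definition coherent (R : realType) (H : normedModType R) (C : set H)
    (T : nat -> H -> H) : Prop :=
  forall z : nat -> H,
    (forall n, C (z n)) ->
    bounded_set (range z) ->
    (\sum_(0 <= n <oo) (`|z n.+1 - z n| ^+ 2)%:E < +oo)%E ->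
    (\sum_(0 <= n <oo) (`|z n - T n (z n)| ^+ 2)%:E < +oo)%E ->
    forall p, weak_cluster_point z p -> (\bigcap_n Fix C (T n)) p.

(* The two predicates below say that x is an infinite run of the algorithm from
   x0; such a run exists only if no step is undefined. *)
Definition haugazeau_seq (R : realType) (H : normedModType R)
    (dot : {dot H for idfun}) (C : set H) (T : nat -> H -> H) (x0 : H)
    (x : nat -> H) : Prop :=
  x 0%N = x0 /\
  forall n, is_metric_projection
    (half_space dot C x0 (x n) `&` half_space dot C (x n) (T n (x n)))
    x0 (x n.+1).

(* The set C_n determined by the iterates x_0, ..., x_(n-1). *)
Fixpoint shrinking_set (R : realType) (H : normedModType R)
    (dot : {dot H for idfun}) (C : set H) (T : nat -> H -> H)
    (x : nat -> H) (n : nat) : set H :=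
  if n is m.+1 then
    shrinking_set dot C T x m `&` half_space dot setT (x m) (T m (x m))
  else C.

Definition shrinking_seq (R : realType) (H : normedModType R)
    (dot : {dot H for idfun}) (C : set H) (T : nat -> H -> H) (x0 : H)
    (x : nat -> H) : Prop :=
  x 0%N = x0 /\
  forall n, is_metric_projection (shrinking_set dot C T x n.+1) x0 (x n.+1).

(* Main.v *)
(* Both algorithms produce points of C such that x_n is the projection of x0 onto
   a convex set containing F and x_(n+1), while x_(n+1) lies in H(x_n, T_n x_n).
   Obtuse angles then give, with p = P_F x0,
     |x_n - x0| <= |p - x0|,
     |x_(n+1) - x_n|^2 <= |x_(n+1) - x0|^2 - |x_n - x0|^2,
     |x_n - T_n x_n| <= |x_(n+1) - x_n|,
   so both series in the definition of coherence converge and all weak cluster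
   points lie in F.  Were x_n not converging to p, an ultrafilter on the indices
   would stay at distance >= e from p; along it x_n converges weakly to some q in
   F, and expanding |p - x_n|^2 with |x_n - x0| <= |p - x0| gives
   e^2 <= 2 <q - p, x0 - p> <= 0 in the limit.
   The ultrafilter limit of <x_n, u> is a bounded linear form in u, so the Riesz
   representation theorem provides q; no weak sequential compactness is needed. *)
Require Import Defs.
From HB Require Import structures.
From mathcomp Require Import all_boot all_order all_algebra.
From mathcomp Require Import all_classical all_reals all_analysis.
From mathcomp Require Import ring lra.

Import Order.TTheory GRing.Theory Num.Theory.
Import numFieldNormedType.Exports.
Local Open Scope classical_set_scope.
Local Open Scope ring_scope.

Set Implicit Arguments.
Unset Strict Implicit.
Unset Printing Implicit Defensive.

Section InnerProduct.
Variables (R : realType) (H : completeNormedModType R) (dot : {dot H for idfun}).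
Hypothesis dot_norm : forall u : H, dot u u = `|u| ^+ 2.
Implicit Types (u v w x y z p q : H) (D : set H).

(** * Inner product algebra and the Cauchy-Schwarz inequality *)

Lemma dotC u v : dot u v = dot v u.
Proof. by rewrite hermC expr0 mul1r. Qed.

Lemma dotDr w u v : dot w (u + v) = dot w u + dot w v.
Proof. exact: linearDr. Qed.

Lemma dotNr w u : dot w (- u) = - dot w u.
Proof. exact: linearNr. Qed.

Lemma dotZr w (a : R) u : dot w (a *: u) = a * dot w u.
Proof. exact: linearZr_LR. Qed.

Lemma dotDl w u v : dot (u + v) w = dot u w + dot v w.
Proof. by rewrite dotC dotDr !(dotC w). Qed.

Lemma dotNl w u : dot (- u) w = - dot u w.
Proof. by rewrite dotC dotNr (dotC w). Qed.

Lemma dotZl w (a : R) u : dot (a *: u) w = a * dot u w.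
Proof. by rewrite dotC dotZr (dotC w). Qed.

Definition dotE := (dotDr, dotNr, dotZr, dotDl, dotNl, dotZl).

Lemma sqr_norm_add u v : `|u + v| ^+ 2 = `|u| ^+ 2 + dot u v *+ 2 + `|v| ^+ 2.
Proof. by rewrite -!dot_norm !dotE (dotC v u); ring. Qed.

(** Squaring the triangle inequality of the given norm and expanding the left side leaves exactly
    this bound. *)
Lemma dot_le_norm u v : dot u v <= `|u| * `|v|.
Proof.
have := sqr_norm_add u v.
have : `|u + v| ^+ 2 <= (`|u| + `|v|) ^+ 2 by rewrite ler_sqr ?nnegrE ?ler_normD ?addr_ge0.
by rewrite mulr2n; move: (`|u+v| ^+ 2) => a ? ?; nra.
Qed.

Lemma normr_dot_le u v : `|dot u v| <= `|u| * `|v|.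
Proof. by rewrite ler_norml dot_le_norm lerNl -dotNl -(normrN u) dot_le_norm. Qed.

Lemma continuous_dotl v : continuous (dot^~ v : H -> R^o).
Proof.
move=> u; apply/cvgrPdist_lt => e e0.
near=> w.
rewrite -dotNl -dotDl; apply: le_lt_trans (normr_dot_le _ _) _.
have vpos : 0 < `|v| + 1 by rewrite ltr_wpDl.
apply: (@le_lt_trans _ _ (`|u - w| * (`|v| + 1))).
  by rewrite ler_wpM2l// lerDl.
rewrite -ltr_pdivlMr//; near: w.
by apply: cvgr_dist_lt; rewrite ?divr_gt0.
Unshelve. all: by end_near. Qed.

(** * Metric projection onto closed convex sets *)

(** This is the parallelogram law for [x - u] and [x - v], arranged so that the distance from [x] to
    the midpoint appears. *)
Lemma parallelogram_sub x u v : `|u - v| ^+ 2 =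
  (`|x - u| ^+ 2) *+ 2 + (`|x - v| ^+ 2) *+ 2 - (`|x - 2^-1 *: (u + v)| ^+ 2) *+ 4.
Proof.
by rewrite -!dot_norm !dotE (dotC u x) (dotC v x) (dotC v u); field.
Qed.

Lemma convex_setP D : convex_set D <->
  forall u v (a : R), 0 <= a -> a <= 1 -> D u -> D v -> D (a *: u + (1 - a) *: v).
Proof.
split=> [cD u v a a0 a1 Du Dv|cD u v l].
  have a01 : Itv.spec (@Itv.num_sem R) (Itv.Real `[0%Z, 1%Z]) a.
    by rewrite /Itv.num_sem/= num_real in_itv/= a0 a1.
  have := cD u v (Itv.mk a01); rewrite !inE => /(_ Du Dv).
  by rewrite /conv/=.
rewrite !inE => Du Dv; exact: (cD u v l%:num).
Qed.

(** A minimizing sequence for the distance to [x] is Cauchy, and completeness of [H] provides its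
    limit. *)
Lemma metric_projection_exists D x : D !=set0 -> closed D -> convex_set D ->
  exists p, is_metric_projection D x p.
Proof.
move=> D0 clD /convex_setP cD.
pose A := [set `|x - q| | q in D].
have A0 : A !=set0 by case: D0 => q Dq; exists `|x - q|, q.
have lbA : lbound A 0 by move=> _ [q _ <-].
have infA : has_inf A by split => //; exists 0.
pose d := inf A.
have d0 : 0 <= d by apply: lb_le_inf.
have dle q : D q -> d <= `|x - q| by move=> Dq; apply: ge_inf; [exists 0|exists q].
have /choice[y yP] (n : nat) : exists q, D q /\ `|x - q| < d + n.+1%:R^-1.
  have [||_ [q Dq <-] lt] := @inf_adherent _ A n.+1%:R^-1 => //.
  by exists q.
(* The parallelogram identity, the midpoint of y m and y n being in D. *)
have close m n : `|y m - y n| ^+ 2 <= (d *+ 4 + 2) * (m.+1%:R^-1 + n.+1%:R^-1).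
  have half : D (2^-1 *: (y m + y n)).
    rewrite scalerDr; have -> : 2^-1 *: y n = (1 - 2^-1) *: y n.
      by congr (_ *: _); field.
    by apply: cD; rewrite ?invr_ge0 ?invf_le1 ?ler1n//; have [] := yP m; have [] := yP n.
  rewrite (parallelogram_sub x).
  have := dle _ half.
  have [_] := yP m; have [_] := yP n.
  (* With a and b the two inverses, the bound is 2(d + a)^2 + 2(d + b)^2 - 4d^2 = 4d(a + b) + 2(a^2
     + b^2); since a, b <= 1, the squares are at most a and b. *)
  have inv1 (k : nat) : 0 < k.+1%:R^-1 :> R /\ k.+1%:R^-1 <= 1 :> R.
    by rewrite invr_gt0 ltr0Sn invf_le1 ?ler1n.
  have [] := inv1 m; have [] := inv1 n.
  have := normr_ge0 (x - y m); have := normr_ge0 (x - y n).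
  move: (m.+1%:R^-1) (n.+1%:R^-1) `|x - y m| `|x - y n| `|x - 2^-1 *: _| => a b c e f *.
  have : c ^+ 2 <= (d + a)^+2 by rewrite ler_sqr ?nnegrE; lra.
  have : e ^+ 2 <= (d + b)^+2 by rewrite ler_sqr ?nnegrE; lra.
  have : d ^+ 2 <= f^+2 by rewrite ler_sqr ?nnegrE; lra.
  nra.
have ycvg : cvg (y @ \oo).
  apply/cauchy_cvgP/cauchyP => e e0.
  have c0 : 0 < d *+ 4 + 2 by rewrite ltr_wpDl ?mulrn_wge0 ?ltr0n.
  have de0 : 0 < e ^+ 2 / (d *+ 4 + 2) / 2.
    by apply: divr_gt0 => //; apply: divr_gt0 => //; exact: exprn_gt0.
  have [N _ small] := near_infty_natSinv_lt (PosNum de0).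
  exists (y N); exists N => // n /= Nn; rewrite -ball_normE/=.
  rewrite -ltr_sqr ?nnegrE//; last exact: ltW.
  apply: le_lt_trans (close N n) _.
  rewrite mulrC -ltr_pdivlMr// [ltRHS]splitr ltrD//; first exact: (small N (leqnn N)).
  exact: (small n Nn).
pose p := lim (y @ \oo).
have Dp : D p.
  by apply: (closed_cvg D clD _ p ycvg); apply: nearW => n; have [] := yP n.
exists p; split=> // q Dq; apply: le_trans (dle q Dq).
have xy : `|x - y n| @[n --> \oo] --> `|x - p|.
  by apply: cvg_norm; apply: cvgB => //; exact: cvg_cst.
apply: (@ler_cvg_to _ _ _ _ _ (fun n => d + n.+1%:R^-1) _ _ xy).
  by rewrite -[X in _ --> X]addr0; apply: cvgD (@cvg_harmonic R); exact: cvg_cst.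
by apply: nearW => n; have [_ /ltW] := yP n.
Qed.

Lemma dist_le_of_dot_le0 x p q : dot (q - p) (x - p) <= 0 -> `|x - p| <= `|x - q|.
Proof.
move=> qp; rewrite -ler_sqr ?nnegrE//.
have -> : x - q = (x - p) + (p - q) by rewrite addrA subrK.
rewrite (sqr_norm_add (x - p)) -(opprB q p) dotNr (dotC (x - p)) normrN.
by have := sqr_ge0 `|q - p|; lra.
Qed.

Lemma metric_projectionP D x p : convex_set D -> is_metric_projection D x p <->
  D p /\ forall q, D q -> dot (q - p) (x - p) <= 0.
Proof.
move=> /convex_setP cD; split=> -[Dp pP]; split=> // q Dq; last exact/dist_le_of_dot_le0/pP.
set a := dot _ _; rewrite leNgt; apply/negP => a0.
pose b := `|q - p| ^+ 2.
have b0 : 0 <= b by exact: sqr_ge0.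
(* Compare p with the points p + t (q - p) of D, 0 <= t <= 1. *)
have key (t : R) : 0 <= t -> t <= 1 -> 0 <= t * (t * b - a *+ 2).
  move=> t0 t1.
  have := pP _ (cD q p t t0 t1 Dq Dp); rewrite -ler_sqr ?nnegrE//.
  have -> : x - (t *: q + (1 - t) *: p) = (x - p) - t *: (q - p).
    by rewrite scalerBl scalerBr scale1r addrCA opprD addrA.
  rewrite (sqr_norm_add (x - p)) dotNr dotZr normrN normrZ exprMn -/b (dotC (x - p)) -/a.
  by rewrite real_normK ?num_real// => ?; nra.
(* The choice t = a / (a + b) lies in (0, 1] even when b = 0, and gives t b <= a < 2a, against
   [key]. *)
have ab0 : 0 < a + b by rewrite ltr_pwDl.
have t0 : 0 < a / (a + b) by exact: divr_gt0.
have t1 : a / (a + b) <= 1 by rewrite ler_pdivrMr// mul1r lerDl.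
have := key _ (ltW t0) t1; rewrite pmulr_rge0// subr_ge0 => ab.
have : a / (a + b) * b <= a by rewrite mulrAC ler_pdivrMr// ler_wpM2l ?ltW// ltr_pwDl.
lra.
Qed.

(** * Half-spaces and the Riesz representation *)

Lemma half_spaceE D x y : half_space dot D x y = D `&` half_space dot setT x y.
Proof. by apply/seteqP; split=> z /=; [move=> []|move=> [? []]]. Qed.

Lemma closed_half_space D x y : closed D -> closed (half_space dot D x y).
Proof.
move=> clD; rewrite half_spaceE; apply: closedI => //.
rewrite (_ : half_space _ _ _ _ = (fun z => dot (z - y) (x - y) : R^o) @^-1` [set t | t <= 0]).
  apply: closed_comp (@closed_le R 0) => z _.
  apply: (@continuous_comp _ _ _ (fun z => z - y) (dot^~ (x - y))).
    by apply: cvgB; [exact: cvg_id|exact: cvg_cst].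
  exact: continuous_dotl.
by apply/seteqP; split=> z /=; [move=> []|].
Qed.

Lemma convex_half_space D x y : convex_set D -> convex_set (half_space dot D x y).
Proof.
move=> /convex_setP cD; apply/convex_setP => u v a a0 a1 [Du u0] [Dv v0]; split.
  exact: cD.
have -> : a *: u + (1 - a) *: v - y = a *: (u - y) + (1 - a) *: (v - y).
  by rewrite !scalerBr addrACA -opprD -scalerDl (addrC a) subrK scale1r.
by rewrite dotDl !dotZl; nra.
Qed.

(* A representative is a multiple of the projection of 0 onto {L = 1}. *)
Lemma riesz_representation (L : H -> R^o) : linear L -> continuous L ->
  exists q, forall u, L u = dot q u.
Proof.
move=> linL cL.
have L0 : L 0 = 0 by have := linL (-1) 0 0; rewrite scaler0 addr0 scaleN1r addNr.
have LZ (a : R) u : L (a *: u) = a * L u.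
  by have := linL a u 0; rewrite L0 !addr0.
have LD u v : L (u + v) = L u + L v.
  by have := linL 1 u v; rewrite !scale1r.
have [[w Lw]|noL] := pselect (exists w, L w != 0); last first.
  exists 0 => u; rewrite dotC linear0r; apply/eqP.
  by rewrite -[_ == _]negbK; apply/negP => Lu; apply: noL; exists u.
pose D := [set u | L u = 1].
have clD : closed D.
  by apply: (@closed_comp _ _ L [set (1 : R)]) => [u _|]; [exact: cL|exact: closed_eq].
have D0 : D !=set0 by exists ((L w)^-1 *: w); rewrite /D/= LZ mulVf.
have cD : convex_set D.
  apply/convex_setP => u v a _ _; rewrite /D/= => Lu Lv.
  by rewrite LD !LZ Lu Lv !mulr1 addrC subrK.
have [p /(metric_projectionP _ _ cD)[Lp pP]] := metric_projection_exists 0 D0 clD cD.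
(* Both [p + v] and [p - v] lie in [D], so the obtuse angle condition at [p] holds with both
   signs. *)
have orth v : L v = 0 -> dot v p = 0.
  move=> Lv; apply/eqP; rewrite eq_le.
  have := pP (p + v); rewrite /D/= LD Lp Lv addr0 => /(_ erefl).
  have := pP (p - v); rewrite /D/= LD -scaleN1r LZ Lp Lv mulr0 addr0 => /(_ erefl).
  rewrite scaleN1r ![p + _]addrC !addrK sub0r !dotE opprK => -> /=.
  by rewrite oppr_le0.
have pn0 : dot p p != 0.
  rewrite dot_norm sqrf_eq0 normr_eq0; apply: contra_eq_neq Lp => ->.
  by rewrite L0 eq_sym oner_neq0.
(* The vector [u - L u *: p] is in the kernel of [L], hence orthogonal to [p], so [dot u p] is
   [L u * dot p p]. *)
exists ((dot p p)^-1 *: p) => u; rewrite dotZl.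
have /orth : L (u - L u *: p) = 0.
  by rewrite LD -scaleNr LZ (Lp : L p = 1) mulr1 subrr.
rewrite !dotE (dotC u) => /eqP; rewrite subr_eq0 => /eqP ->.
by rewrite mulrCA mulVf ?mulr1.
Qed.

(** * Weak limits along ultrafilters *)

Lemma ultra_fmap (S V : Type) (f : S -> V) (U : set_system S) :
  UltraFilter U -> UltraFilter (f @ U).
Proof.
move=> UU; split=> [|G GG sUG]; first exact: fmap_proper_filter.
apply/seteqP; split=> // A GA; have [//|UnA] := in_ultra_setVsetC (f @^-1` A) UU.
by have /filter_ex[y []] : G (A `&` ~` A) by apply: filterI => //; exact: sUG.
Qed.

(** For fixed [u] the numbers [dot (x n) u] stay in a compact segment, so they converge along [U].
    The limit is linear in [u] and bounded by [M * |u|], hence represented by some [q]. *)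
Lemma ultra_weak_limit (U : set_system nat) (x : nat -> H) (M : R) :
  UltraFilter U -> (forall n, `|x n| <= M) ->
  exists q, forall u, (dot (x n) u : R^o) @[n --> U] --> (dot q u : R^o).
Proof.
move=> UU xM.
have /choice[L LP] u : exists l : R, `|l| <= M * `|u| /\
    (dot (x n) u : R^o) @[n --> U] --> (l : R^o).
  have := @segment_compact R (- (M * `|u|)) (M * `|u|).
  have UdU : UltraFilter ((fun n => dot (x n) u : R^o) @ U).
    exact: ultra_fmap.
  rewrite compact_ultra => /(_ ((fun n => dot (x n) u : R^o) @ U) UdU)[].
    apply: (@filterE _ U) => n /=; rewrite in_itv/= -ler_norml.
    by apply: (le_trans (normr_dot_le (x n) u)); rewrite ler_wpM2r.
  move=> l [/= lM ul]; exists l; split=> //.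
  by move: lM; rewrite in_itv/= -ler_norml.
have linL : linear (L : H -> R^o).
  move=> a u v; have [_ Luv] := LP (a *: u + v).
  apply: (cvg_unique _ Luv) => //.
  rewrite (_ : (fun n => _) = (fun n => a *: (dot (x n) u : R^o) + dot (x n) v)).
    by apply: cvgD (LP v).2; apply: cvgZr (LP u).2.
  by apply/funext => n; rewrite dotDr dotZr.
have [|q qP] := riesz_representation linL.
  have Mpos : 0 < M + 1 by rewrite ltr_wpDl// (le_trans (normr_ge0 (x 0%N))).
  move=> u; apply/cvgrPdist_lt => e e0; near=> v.
  have -> : L u - L v = L (u - v).
    by rewrite addrC -scaleN1r -[_ *: L v]/(-1 *: (L v : R^o)) -linL scaleN1r addrC.
  apply: le_lt_trans (LP _).1 _.
  apply: (@le_lt_trans _ _ ((M + 1) * `|u - v|)).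
    by rewrite ler_wpM2r// lerDl.
  rewrite mulrC -ltr_pdivlMr//; near: v.
  by apply: cvgr_dist_lt; rewrite ?divr_gt0.
by exists q => u; rewrite -qP; exact: (LP u).2.
Unshelve. all: by end_near. Qed.

Lemma cvg_initial_topology (S : choiceType) (V : topologicalType) (w : S -> V)
    (F : set_system S) (s : S) : Filter F ->
  w @ F --> w s -> F --> (s : initial_topology w).
Proof.
move=> FF ws A /= [_ [[B oB <-] Bs sBA]].
by apply: (filterS sBA); apply: ws; exact: open_nbhs_nbhs.
Qed.

(** The weak topology is initial for a map into a product, itself a supremum of initial topologies
    of evaluations. Convergence is thus tested on each functional, which Riesz turns into
    [dot^~ u]. *)
Lemma weak_cvg (F : set_system H) q : Filter F ->
  (forall u, (dot v u : R^o) @[v --> F] --> (dot q u : R^o)) ->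
  F --> (q : weak_space H).
Proof.
move=> FF Fq; apply: cvg_initial_topology; apply/cvg_sup => f.
apply: cvg_initial_topology.
have [u uP] := riesz_representation (linearP (sval f)) (svalP f).
suff : (sval f v : R^o) @[v --> F] --> (sval f q : R^o) by [].
have -> : (sval f : H -> R^o) = dot^~ u by apply/funext => v; rewrite uP dotC.
exact: Fq.
Qed.

Lemma strong_cvg_projection D (x : nat -> H) x0 p : convex_set D ->
  is_metric_projection D x0 p -> (forall n, `|x n - x0| <= `|p - x0|) ->
  (forall q, weak_cluster_point x q -> D q) -> x @ \oo --> p.
Proof.
move=> cD /(metric_projectionP _ _ cD)[Dp pP] xb xD.
apply/cvgrPdist_lt => e e0; apply: contrapT => nclose.
pose A := [set n | e <= `|p - x n|].
(* If the complement of [A] were eventual, [x] would eventually stay within [e] of [p], against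
   [nclose]. *)
have PF : ProperFilter (within A \oo).
  apply: Build_ProperFilter => nA; apply: nclose; rewrite /within/= in nA.
  by near=> n; rewrite ltNge; apply/negP; near: n.
have [U [UU sU]] := ultraFilterLemma PF.
have UA : U A by apply: sU; exact: withinT.
have [q xq] : exists q, forall u, (dot (x n) u : R^o) @[n --> U] --> (dot q u : R^o).
  apply: (@ultra_weak_limit _ _ (`|p - x0| + `|x0|)) => n.
  by rewrite -{1}(subrK x0 (x n)) (le_trans (ler_normD _ _))// lerD2r.
have Dq : D q.
  apply: xD; apply: (@cvg_cluster (weak_space H) (x @ U)).
    by move=> B xB; apply: sU; exact: (cvg_within A xB).
  have xUq : (x : nat -> weak_space H) @ U --> (q : weak_space H) by exact: weak_cvg.
  by move=> B B' UB /xUq UB'; apply: (@filter_ex _ (x @ U)); exact: filterI.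
have := pP _ Dq => qp.
(* The norm bound gives |p - x_n|^2 <= 2 <x_n - p, x0 - p>, so an error below e^2 / 2 in the pairing
   with [x0 - p] already contradicts [An]. *)
have e2 : 0 < e ^+ 2 / 2 by rewrite divr_gt0 ?exprn_gt0.
have /cvgrPdist_lt/(_ _ e2) near_q := xq (x0 - p).
have [n [/= + An]] := @filter_ex _ U _ _ (filterI near_q UA).
rewrite ltr_norml => /andP[+ _].
have : e ^+ 2 <= `|p - x n| ^+ 2 by rewrite ler_pXn2r ?nnegrE ?(ltW e0)//.
have : `|x n - x0| ^+ 2 <= `|p - x0| ^+ 2 by rewrite ler_sqr ?nnegrE.
rewrite -!dot_norm !dotE in qp *.
by have := dotC p x0; have := dotC p (x n); have := dotC x0 (x n); lra.
Unshelve. all: by end_near. Qed.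

(** * Convexity and closedness of the common fixed point set *)

Lemma convex_setI D D' : convex_set D -> convex_set D' -> convex_set (D `&` D').
Proof.
move=> /convex_setP cD /convex_setP cD'; apply/convex_setP => u v a a0 a1.
by move=> [Du D'u] [Dv D'v]; split; [exact: cD|exact: cD'].
Qed.

Lemma convex_bigcap (I : Type) (P : set I) (D : I -> set H) :
  (forall i, P i -> convex_set (D i)) -> convex_set (\bigcap_(i in P) D i).
Proof.
move=> cD; apply/convex_setP => u v a a0 a1 Du Dv i Pi.
by have /convex_setP := cD i Pi; apply=> //; [exact: Du|exact: Dv].
Qed.

Lemma nneseries_lty (u : nat -> R) (K : R) : (forall n, 0 <= u n) ->
  (forall n, \sum_(0 <= i < n) u i <= K) ->
  (\sum_(0 <= n <oo) (u n)%:E < +oo)%E.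
Proof.
move=> u0 uK; apply: (@le_lt_trans _ _ K%:E); last exact: ltry.
apply: lime_le; first by apply: is_cvg_nneseries => n _ _; rewrite lee_fin.
by apply: nearW => n; rewrite sumEFin lee_fin.
Qed.

Variable C : set H.
Hypotheses (C_closed : closed C) (C_convex : convex_set C).

(* The inclusion from right to left uses only the half-space at x = z. *)
Lemma FixE (S : H -> H) : T_class dot C S ->
  Fix C S = C `&` \bigcap_(x in C) half_space dot setT x (S x).
Proof.
move=> [CS SP]; apply/seteqP; split=> z.
  by move=> Fz; split=> [|x Cx]; [case: Fz|exact: SP].
move=> [Cz /(_ z Cz)[_ /=]]; rewrite dot_norm => zS; split => //.
apply/esym/eqP; rewrite -subr_eq0 -normr_eq0 -sqrf_eq0.
by rewrite eq_le zS sqr_ge0.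
Qed.

Lemma closed_Fix (S : H -> H) : T_class dot C S -> closed (Fix C S).
Proof.
move=> TS; rewrite FixE//; apply: closedI => //; apply: closed_bigI => x _.
exact/closed_half_space/closedT.
Qed.

Lemma convex_setT : convex_set [set: H].
Proof. exact/convex_setP. Qed.

Lemma convex_Fix (S : H -> H) : T_class dot C S -> convex_set (Fix C S).
Proof.
move=> TS; rewrite FixE//; apply: convex_setI => //; apply: convex_bigcap => x _.
exact/convex_half_space/convex_setT.
Qed.

Variable T : nat -> H -> H.
Hypothesis T_classT : forall n, T_class dot C (T n).
Let F := \bigcap_n Fix C (T n).

Lemma convex_common_Fix : convex_set F.
Proof. by apply: convex_bigcap => n _; exact: convex_Fix. Qed.

Lemma closed_common_Fix : closed F.
Proof. by apply: closed_bigI => n _; exact: closed_Fix. Qed.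

Lemma common_Fix_half_space n x : C x -> F `<=` half_space dot C x (T n x).
Proof.
move=> Cx z Fz; have [_ TP] := T_classT n.
by have [_ zx] := TP x Cx z (Fz n I); split=> //; case: (Fz n I).
Qed.

Lemma common_Fix_sub : F `<=` C.
Proof. by move=> z /(_ 0%N I)[]. Qed.

(** * Convergence argument shared by both algorithms *)

(** The algorithms enter only through three obtuse angles: two at [x n], seen from [p] and from
    [x n.+1], and one at [T n (x n)]. *)
Lemma outer_approximation_cvg (x : nat -> H) x0 p : coherent C T ->
  is_metric_projection F x0 p -> x 0%N = x0 -> (forall n, C (x n)) ->
  (forall n, dot (p - x n) (x0 - x n) <= 0) ->
  (forall n, dot (x n.+1 - x n) (x0 - x n) <= 0) ->
  (forall n, dot (x n.+1 - T n (x n)) (x n - T n (x n)) <= 0) ->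
  x @ \oo --> p.
Proof.
move=> cohT pP xx0 Cx px step1 step2.
have bnd n : `|x n - x0| <= `|p - x0|.
  by rewrite distrC [leRHS]distrC; exact: dist_le_of_dot_le0.
have incr n : `|x n.+1 - x n| ^+ 2 <= `|x n.+1 - x0| ^+ 2 - `|x n - x0| ^+ 2.
  have := step1 n; rewrite -!dot_norm !dotE.
  have := dotC x0 (x n); have := dotC x0 (x n.+1); have := dotC (x n) (x n.+1).
  lra.
have dT n : `|x n - T n (x n)| ^+ 2 <= `|x n.+1 - x n| ^+ 2.
  have := step2 n; have := sqr_ge0 `|x n.+1 - T n (x n)|.
  rewrite -!dot_norm !dotE.
  have := dotC (T n (x n)) (x n); have := dotC (T n (x n)) (x n.+1).
  have := dotC (x n) (x n.+1); lra.
have sum_incr n : \sum_(0 <= i < n) `|x i.+1 - x i| ^+ 2 <= `|p - x0| ^+ 2.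
  (* By telescoping [incr], each partial sum is at most |x_n - x0|^2. *)
  apply: (@le_trans _ _ (`|x n - x0| ^+ 2)); last by rewrite ler_sqr ?nnegrE.
  elim: n => [|n IHn]; first by rewrite big_nil sqr_ge0.
  by rewrite big_nat_recr//=; have := incr n; lra.
apply: (strong_cvg_projection convex_common_Fix pP bnd) => q xq.
apply: (cohT x) => //.
- exists (`|p - x0| + `|x0|); split; first exact: num_real.
  move=> M pM _ [n _ <-] /=; apply: le_trans (ltW pM).
  by rewrite -{1}(subrK x0 (x n)) (le_trans (ler_normD _ _))// lerD2r.
- by apply: nneseries_lty sum_incr => n; exact: sqr_ge0.
- apply: (@nneseries_lty _ (`|p - x0| ^+ 2)) => n; first exact: sqr_ge0.
  by apply: le_trans (sum_incr n); apply: ler_sum => i _; exact: dT.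
Qed.

Variable x0 : H.
Hypothesis x0C : C x0.

(** This starts the Haugazeau induction: at n = 0 the half-space of [x0] and [x 0] imposes no
    constraint. *)
Lemma half_space_self D x : half_space dot D x x = D.
Proof.
by apply/seteqP; split=> z /=; [case|move=> Dz; split=> //; rewrite subrr linear0r].
Qed.

(** * Shrinking projection algorithm *)

Lemma shrinking_set_sub (x : nat -> H) n : shrinking_set dot C T x n `<=` C.
Proof. by elim: n => //= n IHn z [/IHn]. Qed.

Lemma shrinking_set_closed (x : nat -> H) n : closed (shrinking_set dot C T x n).
Proof. by elim: n => //= n IHn; apply: closedI => //; exact/closed_half_space/closedT. Qed.

Lemma shrinking_set_convex (x : nat -> H) n : convex_set (shrinking_set dot C T x n).
Proof.
by elim: n => //= n IHn; apply: convex_setI => //; exact/convex_half_space/convex_setT.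
Qed.

(** Only iterates before [n] are assumed in [C], so that the lemma can serve inside the strong
    induction that constructs the sequence. *)
Lemma common_Fix_shrinking_set (x : nat -> H) n : (forall k, (k < n)%N -> C (x k)) ->
  F `<=` shrinking_set dot C T x n.
Proof.
elim: n => [_|n IHn Cx z Fz]/=; first exact: common_Fix_sub.
split; first by apply: IHn => // k kn; apply: Cx; exact: ltnW.
by have [] := @common_Fix_half_space n _ (Cx n (ltnSn n)) _ Fz.
Qed.

(** This adds the index 0, where the set is [C] and [x0] is its own projection. *)
Lemma shrinking_seq_projection (x : nat -> H) n : shrinking_seq dot C T x0 x ->
  is_metric_projection (shrinking_set dot C T x n) x0 (x n).
Proof.
move=> [xx0 xP]; case: n => [|n]; last exact: xP.
by rewrite xx0; split=> // q _; rewrite subrr normr0.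
Qed.

Lemma shrinking_seq_cvg (x : nat -> H) p : coherent C T ->
  is_metric_projection F x0 p -> shrinking_seq dot C T x0 x -> x @ \oo --> p.
Proof.
move=> cohT pP xS.
have proj n : is_metric_projection (shrinking_set dot C T x n) x0 (x n).
  exact: shrinking_seq_projection.
have Cx n : C (x n) by have [/shrinking_set_sub] := proj n.
have var n := (metric_projectionP _ _ (@shrinking_set_convex x n)).1 (proj n).
have next n : shrinking_set dot C T x n.+1 (x n.+1) by have [] := proj n.+1.
apply: (outer_approximation_cvg cohT pP xS.1 Cx) => n.
- by have [_] := var n; apply; apply: common_Fix_shrinking_set => //; case: pP.
- by have [_] := var n; apply; have [] := next n.
- by have [_ []] := next n.
Qed.

(** The default [x0] makes [proj] total, so the recursions can be written before their sets are
    known to be nonempty. *)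
Let proj D := xget x0 [set q | is_metric_projection D x0 q].

Let projP D : D !=set0 -> closed D -> convex_set D ->
  is_metric_projection D x0 (proj D).
Proof.
move=> D0 clD cD; apply: xgetPex; exact: metric_projection_exists.
Qed.

Lemma shrinking_seq_exists : F !=set0 -> exists x : nat -> H, shrinking_seq dot C T x0 x.
Proof.
move=> [z Fz].
(* The sets C_n depend on all previous iterates: iterate the pair (C_n, x_n). *)
pose next n (s : set H * H) :=
  let D := s.1 `&` half_space dot setT s.2 (T n s.2) in (D, proj D).
pose s := fix s n := if n is m.+1 then next m (s m) else (C, x0).
pose x n := (s n).2.
have sE n : (s n).1 = shrinking_set dot C T x n by elim: n => //= n ->.
exists x; split=> // n.
have xE m : x m.+1 = proj (shrinking_set dot C T x m.+1) by rewrite -sE.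
rewrite xE; apply: projP.
- exists z; apply: common_Fix_shrinking_set => // k _.
  (* Once [x 0], ..., [x k] are in [C], the next set contains [z]; its projection then exists and
     puts [x k.+1] in [C]. *)
  elim/ltn_ind: k => -[//|k IHk].
  apply: (@shrinking_set_sub x k.+1); rewrite xE.
  apply: (projP _ _ _).1; first by exists z; exact: common_Fix_shrinking_set.
  + exact: shrinking_set_closed.
  + exact: shrinking_set_convex.
- exact: shrinking_set_closed.
- exact: shrinking_set_convex.
Qed.

(** * Haugazeau-type algorithm *)

Definition haugazeau_set n x :=
  half_space dot C x0 x `&` half_space dot C x (T n x).

Lemma closed_haugazeau_set n x : closed (haugazeau_set n x).
Proof. by apply: closedI; exact: closed_half_space. Qed.

Lemma convex_haugazeau_set n x : convex_set (haugazeau_set n x).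
Proof. by apply: convex_setI; exact: convex_half_space. Qed.

(** The set projected onto contains [F], and the obtuse angle condition at [y] is precisely
    membership in the half-space of [x0] and [y]; the invariant therefore propagates. *)
Lemma common_Fix_haugazeau_step n x y : C x -> F `<=` half_space dot C x0 x ->
  is_metric_projection (haugazeau_set n x) x0 y ->
  C y /\ F `<=` half_space dot C x0 y.
Proof.
move=> Cx Fx /(metric_projectionP _ _ (@convex_haugazeau_set n x))[[[Cy _] _] yP].
split=> // z Fz; split; first exact: common_Fix_sub.
by apply: yP; split; [exact: Fx|exact: common_Fix_half_space].
Qed.

Lemma haugazeau_seq_cvg (x : nat -> H) p : coherent C T ->
  is_metric_projection F x0 p -> haugazeau_seq dot C T x0 x -> x @ \oo --> p.
Proof.
move=> cohT pP [xx0 xP].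
have inv n : C (x n) /\ F `<=` half_space dot C x0 (x n).
  elim: n => [|n [Cx Fx]]; last exact: common_Fix_haugazeau_step (xP n).
  by rewrite xx0 half_space_self; split=> //; exact: common_Fix_sub.
apply: (outer_approximation_cvg cohT pP xx0) => n.
- exact: (inv n).1.
- by have [Fp _] := pP; have [_ /(_ _ Fp)[]] := inv n.
- by have [[[]]] := xP n.
- by have [[_ []]] := xP n.
Qed.

Lemma haugazeau_seq_exists : F !=set0 -> exists x : nat -> H, haugazeau_seq dot C T x0 x.
Proof.
move=> [z Fz].
pose x := fix x n := if n is m.+1 then proj (haugazeau_set m (x m)) else x0.
(* The invariant is a premise here because it makes the set nonempty, while its own propagation
   needs the projection to exist. *)
have step n : C (x n) -> F `<=` half_space dot C x0 (x n) ->
    is_metric_projection (haugazeau_set n (x n)) x0 (x n.+1).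
  move=> Cx Fx; apply: projP; [|exact: closed_haugazeau_set|exact: convex_haugazeau_set].
  by exists z; split; [exact: Fx|exact: common_Fix_half_space].
exists x; split=> // n.
have [Cx Fx] : C (x n) /\ F `<=` half_space dot C x0 (x n); last exact: step.
elim: n => [|n [Cx Fx]]; last exact: common_Fix_haugazeau_step (step n Cx Fx).
by rewrite half_space_self; split=> //; exact: common_Fix_sub.
Qed.

End InnerProduct.

Theorem theorem6 (R : realType) (H : completeNormedModType R)
  (dot : {dot H for idfun}) (dot_norm : forall u : H, dot u u = `|u| ^+ 2)
  (C : set H) (C_nonempty : C !=set0) (C_closed : closed C)
  (C_convex : convex_set C) (x0 : H) (x0C : C x0)
  (T : nat -> H -> H) (T_classT : forall n, T_class dot C (T n))
  (T_coherent : coherent C T)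
  (F_nonempty : \bigcap_n Fix C (T n) !=set0) :
  exists p : H,
    is_metric_projection (\bigcap_n Fix C (T n)) x0 p /\
    ((exists x : nat -> H, shrinking_seq dot C T x0 x) /\
     forall x : nat -> H, shrinking_seq dot C T x0 x -> x @ \oo --> p) /\
    ((exists x : nat -> H, haugazeau_seq dot C T x0 x) /\
     forall x : nat -> H, haugazeau_seq dot C T x0 x -> x @ \oo --> p).
Proof.
have [p pP] := metric_projection_exists dot_norm x0 F_nonempty
  (closed_common_Fix dot_norm C_closed T_classT)
  (convex_common_Fix dot_norm C_convex T_classT).
exists p; split=> //; split; split.
- exact: shrinking_seq_exists.
- move=> x; exact: shrinking_seq_cvg.
- exact: haugazeau_seq_exists.
- move=> x; exact: haugazeau_seq_cvg.
Qed.
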